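(* Let $G$ be a finite group and let $\tilde\rho_h$ ($h\in G$) be the generalized hidden shift states of $G$ with $m=|G|$. Let $R_G$ be the set of orders of elements of $G$ and $g(G):=\max R_G$. For every integer $k\ge1$, the quantity $$q_k:=\mathrm{tr}\sqrt{\sum_{h\in G}\frac{1}{|G|^2}\big(\tilde\rho_h^{\otimes k}\big)^2}=\frac{1}{|G|}\,\mathrm{tr}\sqrt{\sum_{h\in G}\Big(\frac{1}{|G|}\tilde\rho_h\Big)^{\otimes k}}$$ satisfies $$q_k\le\sqrt{\frac{g(G)^{k+1}}{|G|}}.$$
   Context: Generalized hidden shift states: for a finite group $G$ and $m=|G|$, let $\mathrm{reg}_G$ be the regular representation of $G$ on $\mathbb{C}[G]$ and, for $h\in G$, define the density operator on $\mathbb{C}^{m}\otimes\mathbb{C}[G]$ $$\tilde\rho_h=\frac{1}{m|G|}\sum_{b,c\in\mathbb{Z}/m}|b\rangle\langle c|\otimes \mathrm{reg}_G(h^{b-c}).$$ These satisfy $\tilde\rho_h^2=\frac1{|G|}\tilde\rho_h$, which is why the two expressions for $q_k$ agree. *)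

(* Defs.v *)
From HB Require Import structures.
From mathcomp Require Import all_boot all_order all_algebra all_fingroup.
From mathcomp Require Import mxrepresentation spectral.
From mathcomp Require Import complex reals.
(* Not imported: the infix notation of mxtens for tensor powers overlaps with
   the one of sesquilinear for conjugate transposes. *)
From mathcomp Require mxtens.

Set Implicit Arguments.
Unset Strict Implicit.
Unset Printing Implicit Defensive.
Import Order.TTheory GRing.Theory Num.Theory.
Local Open Scope ring_scope.
Local Open Scope sesquilinear_scope.

Notation tensmx := mxtens.tensmx.
Notation ntensmx := mxtens.ntensmx.

Section MatrixSquareRoot.

Variable C : numClosedFieldType.

Definition psdmx n (A : 'M[C]_n) : Prop :=
  A \is hermsymmx /\ forall u : 'rV[C]_n, 0 <= (u *m A *m u ^t*) 0 0.

(* For a normal matrix A, the unitary spectralmx A diagonalizes A. On positive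
   semidefinite matrices this is the unique positive semidefinite square root:
   see sqrtmx_psd, sqrtmxK and sqrtmx_uniq. *)
Definition sqrtmx n (A : 'M[C]_n) : 'M[C]_n :=
  invmx (spectralmx A) *m diag_mx (map_mx sqrtC (spectral_diag A))
    *m spectralmx A.

Lemma psdmx_spectral_ge0 n (A : 'M[C]_n) i :
  psdmx A -> 0 <= spectral_diag A 0 i.
Proof.
move=> [hA pA]; have nA := hermitian_normalmx hA.
have uP := spectral_unitarymx A; have uP' := spectral_unit A.
have := pA (row i (spectralmx A)).
have -> : row i (spectralmx A) *m A *m (row i (spectralmx A)) ^t* =
          (spectral_diag A 0 i)%:M; last by rewrite mxE eqxx mulr1n.
rewrite {2}(orthomx_spectralP nA) rowE !mulmxA mulmxK // trmx_mul map_mxM.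
rewrite -invmx_unitary // mulmxA mulmxK // -rowE.
apply/matrixP=> j k; rewrite !ord1 !mxE (bigD1 i) //= big1 => [|l /negPf nl].
  by rewrite !mxE !eqxx !mulr1n /= conjC1 mulr1 addr0.
by rewrite !mxE eq_sym nl mulr0n mul0r.
Qed.

Lemma psdmx_diag n (P : 'M[C]_n) (d : 'rV[C]_n) : P \is unitarymx ->
  (forall i, 0 <= d 0 i) -> psdmx (invmx P *m diag_mx d *m P).
Proof.
move=> uP d_ge0; rewrite invmx_unitary //; split=> [|u].
  apply/is_hermitianmxP; rewrite expr0 scale1r !trmx_mul !map_mxM trmxCK.
  rewrite tr_diag_mx map_diag_mx mulmxA; congr (_ *m diag_mx _ *m _).
  by apply/rowP=> i; rewrite mxE; apply/esym/conj_Creal/ger0_real.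
set v := u *m P ^t*; have -> : u *m (P ^t* *m diag_mx d *m P) *m u ^t* =
    v *m diag_mx d *m v ^t*.
  by rewrite /v trmx_mul map_mxM trmxCK !mulmxA.
rewrite mul_mx_diag mxE sumr_ge0 // => i _.
by rewrite !mxE mulrAC mulr_ge0 // mul_conjC_ge0.
Qed.

Lemma sqrtmx_psd n (A : 'M[C]_n) : psdmx A -> psdmx (sqrtmx A).
Proof.
move=> pA; apply: psdmx_diag; first exact: spectral_unitarymx.
by move=> i; rewrite mxE sqrtC_ge0 psdmx_spectral_ge0.
Qed.

Lemma sqrtmxK n (A : 'M[C]_n) : psdmx A -> sqrtmx A *m sqrtmx A = A.
Proof.
move=> [/hermitian_normalmx/orthomx_spectralP dA _]; rewrite [RHS]dA.
rewrite /sqrtmx !mulmxA mulmxK ?spectral_unit //; congr (_ *m _).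
rewrite -mulmxA mulmx_diag; congr (_ *m diag_mx _).
by apply/rowP=> i; rewrite !mxE -expr2 sqrtCK.
Qed.

Lemma sqrtmx_uniq n (A B : 'M[C]_n) :
  psdmx A -> psdmx B -> B *m B = A -> B = sqrtmx A.
Proof.
move=> pA pB BA; have [hA _] := pA; have [hB _] := pB.
have dA := orthomx_spectralP (hermitian_normalmx hA).
have dB := orthomx_spectralP (hermitian_normalmx hB).
rewrite /sqrtmx.
have uP := spectral_unit A; have uQ := spectral_unit B.
have e0 i := psdmx_spectral_ge0 i pA; have d0 i := psdmx_spectral_ge0 i pB.
move: dA dB uP uQ e0 d0.
set P := spectralmx A; set Q := spectralmx B.
set e := spectral_diag A; set d := spectral_diag B.
move=> dA dB uP uQ e0 d0; set W := P *m invmx Q.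
have WE : diag_mx e *m W = W *m (diag_mx d *m diag_mx d).
  have : P *m A *m invmx Q = P *m (B *m B) *m invmx Q by rewrite BA.
  rewrite {1}dA {1 2}dB /W !mulmxA mulmxV // mul1mx => ->.
  by rewrite !mulmxK.
suff WD : diag_mx (map_mx sqrtC e) *m W = W *m diag_mx d.
  rewrite {1}dB; apply: (can_inj (mulKmx uP)); rewrite !mulmxA mulmxV // mul1mx.
  by rewrite -[P *m invmx Q]/W -WD /W mulmxA mulmxKV.
clearbody W; apply/matrixP=> i j; move/matrixP/(_ i j): WE.
rewrite mulmx_diag !mul_diag_mx !mul_mx_diag !mxE.
have [-> | Wn0] := eqVneq (W i j) 0; first by rewrite !mulr0 !mul0r.
rewrite mulrC => /(mulfI Wn0) ->.
by rewrite -expr2 sqrCK // mulrC.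
Qed.

End MatrixSquareRoot.

Section HiddenShift.

Variables (C : numClosedFieldType) (gT : finGroupType) (G : {group gT}).

(* Here m = #|G|; the ordinals b, c : 'I_#|G| represent Z/m, and h ^ (b - c) is
   well defined for h in G as #[h] divides m. The rows of regular_repr C G x
   encode the action g |-> g * x; as an operator on column vectors it maps the
   basis vector of g to that of g * x^-1. Replacing it by left translation
   g |-> x * g conjugates all the states by one and the same permutation
   matrix. *)
Definition hidden_shift_state (h : gT) : 'M[C]_(#|G| * #|G|) :=
  (#|G| * #|G|)%:R^-1 *:
    \sum_(b < #|G|) \sum_(c < #|G|)
      tensmx (delta_mx b c) (regular_repr C G (h ^+ b * h ^- c)%g).

Definition hidden_shift_q (k : nat) : C :=
  \tr (sqrtmx (\sum_(h in G)
    (#|G|%:R ^+ 2)^-1 *: ntensmx (hidden_shift_state h) k ^+ 2)).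

Definition element_orders : seq nat := undup [seq #[x]%g | x in G].

Definition max_order : nat := \max_(r <- element_orders) r.

End HiddenShift.

Arguments hidden_shift_state C {gT} G%_G h%_g.
Arguments hidden_shift_q C {gT} G%_G k%_N.

(* Main.v *)
(* Let N = #|G| and V_h = sum_b |b> (x) reg(h^b), so that V_h^* V_h = N and the
   state of h is V_h V_h^* / N^2: a projection up to a scalar. Both expressions
   for q_k then equal tr (sqrt A) / N, where A is the sum over h of the k-th
   tensor powers of the states divided by N, and tr A = N^(1-k).
   By Cauchy-Schwarz, tr (sqrt A) <= sqrt (rank A * tr A). The state of h lives on
   vectors that are r-periodic in b, with r the order of h; these form a space
   of dimension r N that depends on r only. Hence the terms of A are supported in
   one space of dimension (r N)^k for each order r, and
   rank A <= sum_(r <= g) (r N)^k <= g (g N)^k. *)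
Require Import Defs.
From mathcomp Require Import all_boot all_order all_algebra all_fingroup.
From mathcomp Require Import mxrepresentation spectral ring.
From mathcomp Require Import complex reals.
Import Order.TTheory GRing.Theory Num.Theory.
Local Open Scope ring_scope.

(** * Tensor powers of products, scalar multiples and scalar matrices *)

Section TensorPowers.

Lemma ntensmx_mul (R : comPzRingType) m n p (A : 'M[R]_(m, n))
    (B : 'M[R]_(n, p)) k :
  ntensmx (A *m B) k = ntensmx A k *m ntensmx B k.
Proof.
(* The power of exponent 0 is the 1 x 1 identity and that of exponent 1 is the matrix itself, so the
   induction starts at exponent 1. *)
case: k => [|k]; first by rewrite mulmx1.
elim: k => [//|k IHk]; rewrite !mxtens.ntensmxSS IHk.
by rewrite mxtens.tensmx_mul.
Qed.

Lemma tensmxZ (R : comPzRingType) m n p q a b (A : 'M[R]_(m, n))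
    (B : 'M[R]_(p, q)) :
  tensmx (a *: A) (b *: B) = (a * b) *: tensmx A B.
Proof. by apply/matrixP=> i j; rewrite !mxE mulrACA. Qed.

Lemma ntensmxZ (R : comPzRingType) m n a (A : 'M[R]_(m, n)) k :
  ntensmx (a *: A) k = a ^+ k *: ntensmx A k.
Proof.
case: k => [|k]; first by rewrite expr0 scale1r.
elim: k => [|k IHk]; first by rewrite expr1.
by rewrite !mxtens.ntensmxSS IHk tensmxZ -exprS.
Qed.

Lemma tens_scalar_scalar_mx (R : pzRingType) m n (a b : R) :
  tensmx (a%:M : 'M_m) (b%:M : 'M_n) = (a * b)%:M.
Proof.
apply/matrixP=> i j; case: (mxtens.mxtens_indexP i) => i1 i2.
case: (mxtens.mxtens_indexP j) => j1 j2.
rewrite mxtens.tensmxE !mxE (can_eq (@mxtens.mxtens_indexK _ _)) xpair_eqE.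
by case: eqP => _; case: eqP => _; rewrite ?mulr0n ?mulr1n ?mulr0 ?mul0r.
Qed.

Lemma ntensmx_scalar (R : pzRingType) n (a : R) k :
  ntensmx (a%:M : 'M_n) k = (a ^+ k)%:M.
Proof.
case: k => [|k]; first by rewrite expr0.
elim: k => [|k IHk]; first by rewrite expr1.
by rewrite !mxtens.ntensmxSS IHk tens_scalar_scalar_mx -exprS.
Qed.

Lemma tensmx_suml (R : pzRingType) m n p q (I : finType) (F : I -> 'M[R]_(m, n))
    (B : 'M[R]_(p, q)) :
  tensmx (\sum_i F i) B = \sum_i tensmx (F i) B.
Proof.
apply/matrixP=> i j; rewrite mxE !summxE mulr_suml.
by apply: eq_bigr => l _; rewrite mxE.
Qed.

End TensorPowers.

(** * Positive semidefinite matrices, and the trace of a square root against the rank *)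

Section ConjugateTranspose.

Variable C : numClosedFieldType.
Local Open Scope sesquilinear_scope.

Lemma ctrmx_tens m n p q (A : 'M[C]_(m, n)) (B : 'M[C]_(p, q)) :
  (tensmx A B) ^t* = tensmx (A ^t* ) (B ^t* ).
Proof. by rewrite mxtens.trmx_tens mxtens.map_mxT. Qed.

Lemma ctrmx_ntens m n (A : 'M[C]_(m, n)) k :
  (ntensmx A k) ^t* = ntensmx (A ^t* ) k.
Proof.
case: k => [|k]; first by rewrite !mxtens.ntensmx0 trmx1 map_mx1.
by elim: k => [//|k IHk]; rewrite !mxtens.ntensmxSS ctrmx_tens IHk.
Qed.

Lemma ctrmx_sum m n (I : finType) (F : I -> 'M[C]_(m, n)) :
  (\sum_i F i) ^t* = \sum_i (F i) ^t*.
Proof. by rewrite raddf_sum map_mx_sum. Qed.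

Lemma ctrmx_delta m n (i : 'I_m) (j : 'I_n) :
  (delta_mx i j : 'M[C]__) ^t* = delta_mx j i.
Proof. by rewrite trmx_delta map_delta_mx. Qed.

Lemma psdmx_gram m n (W : 'M[C]_(m, n)) : psdmx (W *m W ^t* ).
Proof.
split=> [|u].
  by apply/is_hermitianmxP; rewrite expr0 scale1r trmx_mul map_mxM trmxCK.
rewrite mulmxA -mulmxA -map_mxM -trmx_mul mxE sumr_ge0 // => i _.
by rewrite !mxE mul_conjC_ge0.
Qed.

Lemma psdmx_sum n (I : finType) (P : pred I) (F : I -> 'M[C]_n) :
  (forall i, P i -> psdmx (F i)) -> psdmx (\sum_(i | P i) F i).
Proof.
move=> pF; split=> [|u].
  apply/is_hermitianmxP; rewrite expr0 scale1r raddf_sum map_mx_sum.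
  apply: eq_bigr => i /pF[/is_hermitianmxP]; by rewrite expr0 scale1r.
rewrite mulmx_sumr mulmx_suml summxE sumr_ge0 // => i /pF[_]; exact.
Qed.

Lemma psdmxZ n a (A : 'M[C]_n) : 0 <= a -> psdmx A -> psdmx (a *: A).
Proof.
move=> a_ge0 [/is_hermitianmxP hA pA]; split=> [|u].
  apply/is_hermitianmxP; move: hA; rewrite !expr0 !scale1r => {1}->.
  by rewrite linearZ map_mxZ /= conj_Creal ?ger0_real.
by rewrite -scalemxAr -scalemxAl mxE mulr_ge0.
Qed.

(** Uniqueness of the positive semidefinite root; this is what takes 1/N^2 out of the root in
    [hidden_shift_q]. *)
Lemma sqrtmxZ n a (A : 'M[C]_n) :
  0 <= a -> psdmx A -> sqrtmx (a ^+ 2 *: A) = a *: sqrtmx A.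
Proof.
move=> a_ge0 pA; apply/esym/sqrtmx_uniq.
- by apply: psdmxZ => //; rewrite exprn_ge0.
- exact/psdmxZ/sqrtmx_psd.
- by rewrite -scalemxAl -scalemxAr scalerA sqrtmxK.
Qed.

(** Lagrange's identity: twice the gap is the double sum of (s i - s j)^2, and these squares are
    nonnegative in [C] because the s i are real. *)
Lemma sum_sqr_le (I : finType) (P : pred I) (s : I -> C) :
  (forall i, 0 <= s i) ->
  (\sum_(i | P i) s i) ^+ 2 <= #|P|%:R * \sum_(i | P i) s i ^+ 2.
Proof.
move=> s_ge0; rewrite -subr_ge0 -(pmulrn_lge0 _ (ltn0Sn 1)).
suff -> : (#|P|%:R * \sum_(i | P i) s i ^+ 2 - (\sum_(i | P i) s i) ^+ 2) *+ 2 =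
    \sum_(i | P i) \sum_(j | P j) (s i - s j) ^+ 2.
  apply: sumr_ge0 => i _; apply: sumr_ge0 => j _.
  by rewrite real_exprn_even_ge0 // rpredB ?ger0_real.
under [RHS]eq_bigr => i _.
  under eq_bigr => j _ do rewrite sqrrB.
  rewrite big_split sumrB /= sumr_const sumrMnl -mulr_sumr.
  over.
rewrite big_split sumrB /= sumr_const (sumrMnl _ _ _ #|P|) (sumrMnl _ _ _ 2).
by rewrite -mulr_suml -expr2 [RHS]addrAC -mulr2n -mulrnBl mulr_natl.
Qed.

(** The principal submatrix on the nonzero entries is invertible, and passing to a submatrix cannot
    raise the rank. *)
Lemma leq_mxrank_diag n (d : 'rV[C]_n) :
  (#|[pred i | d 0%R i != 0%R]| <= \rank (diag_mx d))%N.
Proof.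
set P := [pred i | _]; pose e := @enum_val _ P.
have eE : mxsub e e (diag_mx d) =
    rowsub e 1%:M *m (diag_mx d) *m colsub e 1%:M.
  by rewrite mul_rowsub_mx mul1mx mulmx_colsub mulmx1 -mxsubcr.
have uD : mxsub e e (diag_mx d) \in unitmx.
  have -> : mxsub e e (diag_mx d) = diag_mx (colsub e d).
    by apply/matrixP=> i j; rewrite !mxE (inj_eq enum_val_inj).
  rewrite unitmxE det_diag unitfE; apply/prodf_neq0 => i _.
  by rewrite mxE; apply: (enum_valP i).
rewrite -(mxrank_unit uD) eE.
exact: leq_trans (mxrankM_maxl _ _) (mxrankM_maxr _ _).
Qed.

(* Cauchy-Schwarz over the nonzero eigenvalues, of which there are \rank A. *)
Lemma mxtrace_sqrtmx_le n (A : 'M[C]_n) :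
  psdmx A -> \tr (sqrtmx A) <= sqrtC ((\rank A)%:R * \tr A).
Proof.
move=> pA; have [hA _] := pA.
have dA := orthomx_spectralP (hermitian_normalmx hA).
have uP := spectral_unit A; have e_ge0 i := psdmx_spectral_ge0 i pA.
rewrite /sqrtmx; move: dA uP e_ge0.
set P := spectralmx A; set e := spectral_diag A => dA uP e_ge0.
have tre : \tr A = \sum_i e 0 i.
  by rewrite dA mxtrace_mulC mulmxA mulmxV // mul1mx mxtrace_diag.
have rke : (#|[pred i | e 0%R i != 0%R]| <= \rank A)%N.
  rewrite (leq_trans (leq_mxrank_diag _ e)) //.
  have -> : diag_mx e = P *m A *m invmx P.
    by rewrite dA !mulmxA mulmxV // mul1mx mulmxK.
  exact: leq_trans (mxrankM_maxl _ _) (mxrankM_maxr _ _).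
rewrite mxtrace_mulC mulmxA mulmxV // mul1mx mxtrace_diag.
have s_ge0 i : 0 <= sqrtC (e 0 i) by rewrite sqrtC_ge0.
under eq_bigr => i _ do rewrite mxE.
have S_ge0 : 0 <= \sum_i sqrtC (e 0 i) by apply: sumr_ge0.
have trA_ge0 : 0 <= \tr A by rewrite tre sumr_ge0.
suff le_sqr : (\sum_i sqrtC (e 0 i)) ^+ 2 <= (\rank A)%:R * \tr A.
  by rewrite -[leLHS]sqrCK // ler_sqrtC ?exprn_ge0 ?nnegrE // mulr_ge0 ?ler0n.
apply: (@le_trans _ _ (#|[pred i | e 0 i != 0]|%:R * \tr A)); last first.
  by rewrite ler_wpM2r ?ler_nat.
rewrite tre [in leLHS](bigID [pred i | e 0 i != 0]) /= [X in _ + X]big1.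
  rewrite addr0 (le_trans (sum_sqr_le _ _ _ s_ge0)) // ler_wpM2l ?ler0n //.
  rewrite [leRHS](bigID [pred i | e 0 i != 0]) /= [X in _ + X]big1.
    by rewrite addr0; under eq_bigr => i _ do rewrite sqrtCK.
  by move=> i /negPn/eqP.
by move=> i /negPn/eqP->; rewrite sqrtC0.
Qed.

End ConjugateTranspose.

(** * Factorization of the states, rank and trace of their sum, and the bound *)

Section HiddenShift.

Variables (C : numClosedFieldType) (gT : finGroupType) (G : {group gT}).
Local Notation N := #|G|.
Local Notation rG := (regular_repr C G).
Local Open Scope sesquilinear_scope.

(* Up to a scalar, an isometry onto the support of the hidden shift state. *)
Definition shift_mx (h : gT) : 'M[C]_(N * N, 1 * N) :=
  \sum_(b < N) tensmx (delta_mx b 0) (rG (h ^+ b)%g).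

Lemma ctrmx_regular x : x \in G -> (rG x) ^t* = rG (x^-1)%g.
Proof.
move=> Gx; apply/matrixP=> i j; rewrite !mxE eqxx /= conjC_nat; congr (_%:R).
rewrite -(inj_eq enum_val_inj) -[in RHS](inj_eq enum_val_inj).
rewrite !gring_indexK ?groupM ?groupV ?enum_valP // eq_sym.
by rewrite (can2_eq (mulgK x) (mulgKV x)) eq_sym.
Qed.

Lemma ctrmx_shift h : h \in G ->
  (shift_mx h) ^t* = \sum_(b < N) tensmx (delta_mx 0 b) (rG (h ^- b)%g).
Proof.
move=> Gh; rewrite ctrmx_sum; apply: eq_bigr => b _.
by rewrite ctrmx_tens ctrmx_delta ctrmx_regular ?groupX.
Qed.

Lemma hidden_shift_stateE h : h \in G ->
  hidden_shift_state C G h = (N * N)%:R^-1 *: (shift_mx h *m (shift_mx h) ^t* ).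
Proof.
move=> Gh; rewrite ctrmx_shift // mulmx_suml; congr (_ *: _).
apply: eq_bigr => b _; rewrite mulmx_sumr; apply: eq_bigr => c _.
by rewrite mxtens.tensmx_mul mul_delta_mx repr_mxM ?groupV ?groupX.
Qed.

Lemma shift_mx_isometry h : h \in G ->
  (shift_mx h) ^t* *m shift_mx h = N%:R%:M.
Proof.
move=> Gh; rewrite ctrmx_shift // mulmx_suml.
(* Only the N diagonal pairs b = c survive, each contributing reg(1). *)
transitivity (\sum_(b < N) (1%:M : 'M[C]_(1 * N))); last first.
  by rewrite sumr_const card_ord -scaler_nat scale_scalar_mx mulr1.
apply: eq_bigr => b _; rewrite mulmx_sumr (bigD1 b) //= big1 => [|c /negPf cb].
  rewrite mxtens.tensmx_mul mul_delta_mx -repr_mxM ?groupV ?groupX // mulVg.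
  rewrite repr_mx1 addr0 [delta_mx _ _]mx11_scalar mxE eqxx /=.
  by rewrite tens_scalar_scalar_mx mulr1.
by rewrite mxtens.tensmx_mul mul_delta_mx_cond eq_sym cb mulr0n mxtens.tens0mx.
Qed.

(** Row i is the indicator of the residue class of i, so the rows span the r-periodic vectors. *)
Definition residue_mx r : 'M[C]_(r, N) :=
  \matrix_(i, j) (i == (j %% r)%N :> nat)%:R.

(* The blocks |b><c| (x) reg (h ^ (b - c)) depend on c modulo #[h] only. *)
Lemma ctrmx_shift_factor h : h \in G -> exists X,
  (shift_mx h) ^t* = X *m tensmx (residue_mx #[h]%g) 1%:M.
Proof.
move=> Gh; rewrite ctrmx_shift //.
(* The same sum over a single period; [residue_mx] repeats it along all b < N. *)
exists (\sum_(c < #[h]%g) tensmx (delta_mx 0 c) (rG (h ^- c)%g)).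
rewrite mulmx_suml.
under [RHS]eq_bigr => c _.
  rewrite mxtens.tensmx_mul mulmx1.
  have -> : delta_mx 0 c *m residue_mx #[h]%g =
      \sum_(b < N) (c == (b %% #[h]%g)%N :> nat)%:R *: (delta_mx 0 b : 'rV_N).
    rewrite -rowE [LHS]row_sum_delta; apply: eq_bigr => b _.
    by rewrite !mxE.
  rewrite tensmx_suml; over.
rewrite exchange_big; apply: eq_bigr => b _.
rewrite (bigD1 (Ordinal (ltn_pmod b (order_gt0 h)))) //= big1 => [|c].
  by rewrite eqxx scale1r addr0 -expg_mod_order.
by rewrite -val_eqE /= => /negPf->; rewrite scale0r mxtens.tens0mx.
Qed.

Lemma order_le_max h : h \in G -> (#[h]%g <= max_order G)%N.
Proof.
move=> Gh; apply: (@leq_bigmax_seq _ _ predT id) => //.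
by rewrite mem_undup; apply: image_f.
Qed.

Lemma mxrank_sum_state k :
  (\rank (\sum_(h in G)
    ntensmx (N%:R^-1 *: hidden_shift_state C G h) k)%R
   <= max_order G * (max_order G * N) ^ k)%N.
Proof.
set g := max_order G.
(* Its row space contains the rows of the k-th powers for every h of order r, so the rank is counted
   once per order and not once per element. *)
pose U r : 'M[C]_((r * N) ^ k, (N * N) ^ k) :=
  ntensmx (tensmx (residue_mx r) 1%:M) k.
have sub_U : ((\sum_(h in G)
    ntensmx (N%:R^-1 *: hidden_shift_state C G h) k)%R
    <= \sum_(r < g) <<U r.+1>>)%MS.
  apply: summx_sub => h Gh; have [X defX] := ctrmx_shift_factor _ Gh.
  (* Orders run from 1 to g, so the index r < g stands for the order r + 1. *)
  have ltr : (#[h]%g.-1 < g)%N by rewrite prednK ?order_gt0 // order_le_max.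
  apply: (sumsmx_sup (Ordinal ltr)) => //=; rewrite genmxE prednK ?order_gt0 //.
  rewrite hidden_shift_stateE // !ntensmxZ !ntensmx_mul defX ntensmx_mul.
  by rewrite !scalemx_sub // mulmxA submxMl.
apply: leq_trans (mxrankS sub_U) _.
apply: leq_trans (_ : (\sum_(r < g) \rank <<U r.+1>>)%N <= _)%N.
  exact: mxrank_sum_leqif.
have -> : (g * (g * N) ^ k = \sum_(r < g) (g * N) ^ k)%N.
  by rewrite sum_nat_const card_ord.
apply: leq_sum => r _.
rewrite mxrank_gen (leq_trans (rank_leq_row _)) //.
have [->|k_gt0] := posnP k; first by rewrite !expn0.
by rewrite leq_exp2r // leq_mul2r ltn_ord orbT.
Qed.

(** A tensor power of a Gram matrix is the Gram matrix of the tensor power. *)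
Lemma psdmx_ntens_state k h :
  h \in G -> psdmx (ntensmx (N%:R^-1 *: hidden_shift_state C G h) k).
Proof.
move=> Gh; rewrite hidden_shift_stateE // scalerA ntensmxZ ntensmx_mul.
rewrite -ctrmx_ntens; apply/psdmxZ/psdmx_gram.
by rewrite exprn_ge0 // mulr_ge0 ?invr_ge0 ?ler0n.
Qed.

Lemma natG_neq0 : (N%:R : C) != 0.
Proof. by rewrite pnatr_eq0 -lt0n cardG_gt0. Qed.

(** The inner factor V_h^* V_h = N collapses, and N / N^4 = (1/N) (1/N^2). *)
Lemma sqr_hidden_shift_state h : h \in G ->
  hidden_shift_state C G h *m hidden_shift_state C G h =
    N%:R^-1 *: hidden_shift_state C G h.
Proof.
move=> Gh; rewrite hidden_shift_stateE // -scalemxAl -scalemxAr !mulmxA.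
rewrite -[_ *m _ *m shift_mx h]mulmxA shift_mx_isometry // mul_mx_scalar.
rewrite -scalemxAl !scalerA; congr (_ *: _).
by rewrite natrM; field; rewrite natG_neq0.
Qed.

Lemma mxtrace_sum_state k :
  \tr (\sum_(h in G) ntensmx (N%:R^-1 *: hidden_shift_state C G h) k) =
    N%:R / N%:R ^+ k.
Proof.
rewrite raddf_sum (eq_bigr (fun=> (N%:R ^+ k)^-1)) /= => [|h Gh].
  by rewrite sumr_const mulr_natl.
rewrite hidden_shift_stateE // scalerA ntensmxZ ntensmx_mul mxtraceZ.
(* Cyclicity leaves the k-th power of N times the identity of size N, so each h contributes N^(-3k)
   N^k N^k = N^(-k). *)
rewrite mxtrace_mulC -ntensmx_mul shift_mx_isometry // ntensmx_scalar.
rewrite mxtrace_scalar -[X in _ * X]mulr_natl mul1n natrX -!exprMn -exprVn.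
by congr (_ ^+ k); rewrite natrM; field; rewrite natG_neq0.
Qed.

Lemma hidden_shift_qE k :
  hidden_shift_q C G k = N%:R^-1 * \tr (sqrtmx (\sum_(h in G)
    ntensmx (N%:R^-1 *: hidden_shift_state C G h) k)).
Proof.
rewrite -mxtraceZ -sqrtmxZ ?invr_ge0 ?ler0n //; last first.
  by apply: psdmx_sum => h; apply: psdmx_ntens_state.
rewrite scaler_sumr exprVn; congr (\tr (sqrtmx _)); apply: eq_bigr => h Gh.
by rewrite -sqr_hidden_shift_state // ntensmx_mul.
Qed.

Lemma hidden_shift_q_le k :
  hidden_shift_q C G k <= sqrtC ((max_order G)%:R ^+ k.+1 / N%:R).
Proof.
set A := \sum_(h in G) ntensmx (N%:R^-1 *: hidden_shift_state C G h) k.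
have pA : psdmx A by apply: psdmx_sum => h; apply: psdmx_ntens_state.
rewrite hidden_shift_qE -/A ler_pdivrMl ?ltr0n ?cardG_gt0 //.
apply: le_trans (mxtrace_sqrtmx_le _ _ _ pA) _.
have N_ge0 : 0 <= N%:R :> C by rewrite ler0n.
(* The factor N on the right enters the root as N^2, so that only radicands remain to be
   compared. *)
rewrite -[X in _ <= X * _](sqrCK N_ge0) -sqrtCM ?nnegrE ?exprn_ge0 ?mulr_ge0 ?invr_ge0
  ?exprn_ge0 ?ler0n //.
have trA_ge0 : 0 <= \tr A.
  by rewrite mxtrace_sum_state mulr_ge0 ?invr_ge0 ?exprn_ge0.
rewrite ler_sqrtC ?nnegrE ?mulr_ge0 ?invr_ge0 ?exprn_ge0 ?ler0n //.
(* An exact identity, as tr A = N^(1-k). Of the k + 1 factors g, one counts the possible orders and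
   k come from the dimension (g N)^k. *)
have -> : N%:R ^+ 2 * ((max_order G)%:R ^+ k.+1 / N%:R) =
    (max_order G * (max_order G * N) ^ k)%:R * \tr A.
  rewrite mxtrace_sum_state natrM natrX natrM exprMn [_ ^+ k.+1]exprS.
  by field; rewrite natG_neq0 expf_neq0 ?natG_neq0.
by rewrite ler_wpM2r // ler_nat mxrank_sum_state.
Qed.

End HiddenShift.

Theorem proposition10 (R : realType) (gT : finGroupType) (G : {group gT})
    (k : nat) (hk : (1 <= k)%N) :
  hidden_shift_q R[i] G k =
    #|G|%:R^-1 *
      \tr (sqrtmx (\sum_(h in G)
        ntensmx (#|G|%:R^-1 *: hidden_shift_state R[i] G h) k))
  /\ hidden_shift_q R[i] G k <= sqrtC ((max_order G)%:R ^+ k.+1 / #|G|%:R).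
Proof. by split; [apply: hidden_shift_qE | apply: hidden_shift_q_le]. Qed.
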